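(* Let $n\ge 0$ be an integer and let $a$ be a real number that is not an integer multiple of $\pi$. Then $$\prod_{j=n+1}^{\infty}\left(\frac{2^{j-n}}{a}\tan\!\left(2^{n-j}a\right)\right)^{2^{j-1}}=\frac{a^{2^{n}}}{\left(\sin a\right)^{2^{n}}} .$$
   Context: An infinite product $\prod_{j=n+1}^{\infty}c_j$ means $\lim_{M\to\infty}\prod_{j=n+1}^{M}c_j$. *)

(* Defs.v *)
From HB Require Import structures.
From mathcomp Require Import all_boot all_order all_algebra.
From mathcomp Require Import all_classical all_reals all_analysis.

Set Implicit Arguments.
Unset Strict Implicit.
Unset Printing Implicit Defensive.

Import GRing.Theory.
Import numFieldNormedType.Exports.

Local Open Scope classical_set_scope.
Local Open Scope ring_scope.

(* \prod_(j = m)^oo c_j converges, with value l. Since R is Hausdorff, l is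
   unique, so this is the equation "\prod_(j = m)^oo c_j = l", existence of the
   limit included. *)
Definition infinite_prod_eq (R : realType) (m : nat) (c : nat -> R) (l : R)
    : Prop :=
  (fun M : nat => \prod_(m <= j < M.+1) c j) @ \oo --> l.

(* Main.v *)
(** Write [s x = sin x / x].  The double-angle formula gives
    [tan x / x = s x ^+ 2 / s (2 x)], so with [b_j = 2 ^ (n - j) * a] the [j]-th
    factor is [f j / f (j - 1)], where [f j = s b_j ^+ (2 ^ j)].  The product up
    to [M] telescopes to [f M / f n], and [f M] tends to 1: by the mean value
    theorem [s x] is the cosine of some [c] with [|c| <= |x|], so
    [|1 - f M| <= 2 ^ M * |1 - s b_M| <= 2 ^ M * b_M ^+ 2], which is
    [O(2 ^ - M)]. *)
Require Import Defs.
From HB Require Import structures.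
From mathcomp Require Import all_boot all_order all_algebra.
From mathcomp Require Import all_classical all_reals all_analysis.
From mathcomp Require Import ring lra.

Set Implicit Arguments.
Unset Strict Implicit.
Unset Printing Implicit Defensive.

Import GRing.Theory.
Import numFieldNormedType.Exports.

Local Open Scope classical_set_scope.
Local Open Scope ring_scope.

Import Order.TTheory Num.Theory.

(** The absolute value hides the sign [(-1) ^ k]; only the zeros of [sin] matter later. *)
Lemma norm_sinD_intmul_pi (R : realType) (k : int) (x : R) :
  `|sin (x + k%:~R * pi)| = `|sin x|.
Proof.
have natP (m : nat) (y : R) : `|sin (y + m%:R * pi)| = `|sin y|.
  by rewrite mulr_natl (alternatingn (@sinDpi R)) normrM normrX normrN1
    expr1n mul1r.
case: k => m; first exact: natP.
by rewrite -(natP m.+1) NegzE mulrNz mulNr subrK.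
Qed.

(** Subtracting [floor (x / pi) * pi] leaves a zero of [sin] in [[0, pi)], and [sin] is positive on
    [(0, pi)]. *)
Lemma sin_eq0_intmul_pi (R : realType) (x : R) :
  sin x = 0 -> exists k : int, x = k%:~R * pi.
Proof.
move=> sx0; have pi0 := pi_gt0 R.
pose k := Num.floor (x / pi); exists k; apply/eqP; rewrite -subr_eq0.
have /andP[kx xk] := floor_itv (x / pi).
have y_ge0 : 0 <= x - k%:~R * pi by rewrite subr_ge0 -ler_pdivlMr.
have y_ltpi : x - k%:~R * pi < pi.
  rewrite ltrBlDr -[X in X + _]mul1r -mulrDl -ltr_pdivrMr//.
  by rewrite intrD addrC in xk.
case: (eqVneq (x - k%:~R * pi) 0) => // y_neq0.
have : 0 < sin (x - k%:~R * pi) by rewrite sin_gt0_pi// lt0r y_neq0 y_ge0.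
have := norm_sinD_intmul_pi (- k) x; rewrite mulrNz mulNr sx0 normr0.
by move/eqP; rewrite normr_eq0 => /eqP ->; rewrite ltxx.
Qed.

Lemma sinc_cos (R : realType) (x : R) : x != 0 ->
  exists2 c, `|c| <= `|x| & sin x / x = cos c.
Proof.
move=> x0.
have sin' y : y \in `]0, `|x|[ -> is_derive y 1 sin (cos y).
  by move=> _; exact: is_derive_sin.
have [c] := MVT_segment (normr_ge0 x) sin'
  (continuous_subspaceT (@continuous_sin R)).
rewrite in_itv /= sin0 !subr0 => /andP[c0 cx] sE.
exists c; first by rewrite ger0_norm.
have <- : sin `|x| / `|x| = cos c by rewrite sE mulfK// normr_eq0.
(* [sin x / x] is even, so the case of [|x|] gives that of [x]. *)
by case: (ler0P x) => // _; rewrite sinN invrN mulrNN.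
Qed.

Lemma norm_sin_le (R : realType) (x : R) : `|sin x| <= `|x|.
Proof.
have [->|x0] := eqVneq x 0; first by rewrite sin0.
have [c _ sE] := sinc_cos x0.
have -> : sin x = cos c * x by rewrite -sE divfK.
by rewrite normrM ler_piMl// cos_max.
Qed.

(** Half-angle formula: [1 - cos x] is twice the square of [sin (x / 2)], hence at most
    [x ^+ 2 / 2]. *)
Lemma norm_1Bcos_le (R : realType) (x : R) : `|1 - cos x| <= x ^+ 2.
Proof.
have xE : x = (x / 2) *+ 2 by rewrite -mulr_natr divfK.
have -> : 1 - cos x = sin (x / 2) ^+ 2 *+ 2.
  by rewrite {1}xE cos_mulr2n cos2sin2; ring.
have : sin (x / 2) ^+ 2 <= (x / 2) ^+ 2.
  by rewrite -real_normK ?num_real// -[leRHS]real_normK ?num_real//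
    lerXn2r ?nnegrE// norm_sin_le.
rewrite ger0_norm ?mulrn_wge0 ?sqr_ge0// => h.
have := sqr_ge0 x; have : (x / 2) ^+ 2 = x ^+ 2 / 4 by field.
by rewrite mulr2n; lra.
Qed.

Lemma norm_1BX_le (R : realDomainType) (x : R) (N : nat) :
  `|x| <= 1 -> `|1 - x ^+ N| <= N%:R * `|1 - x|.
Proof.
move=> x1; elim: N => [|N IH]; first by rewrite subrr normr0 mul0r.
(* As [|x| <= 1], raising the exponent by one costs at most [|1 - x|]. *)
have -> : 1 - x ^+ N.+1 = (1 - x) + x * (1 - x ^+ N) by rewrite exprS; ring.
rewrite -natr1 mulrDl mul1r addrC (le_trans (ler_normD _ _))//.
by rewrite lerD// normrM (le_trans _ IH)// ler_piMl.
Qed.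

Lemma sincX_bound (R : realType) (x : R) (N : nat) : x != 0 ->
  `|1 - (sin x / x) ^+ N| <= N%:R * x ^+ 2.
Proof.
move=> /sinc_cos[c cx ->]; rewrite (le_trans (norm_1BX_le _ (cos_max c)))//.
rewrite ler_wpM2l// (le_trans (norm_1Bcos_le c))//.
by rewrite -real_normK ?num_real// -[leRHS]real_normK ?num_real//
  lerXn2r ?nnegrE.
Qed.

Lemma tan_div_sinc (R : realType) (x : R) : sin (x *+ 2) != 0 ->
  x^-1 * tan x = (sin x / x) ^+ 2 / (sin (x *+ 2) / (x *+ 2)).
Proof.
have [->|x0] := eqVneq x 0; first by rewrite mul0rn sin0 eqxx.
(* The hypothesis on [sin (2 x) = 2 sin x cos x] makes every denominator nonzero. *)
rewrite sin_mulr2n mulrn_eq0 mulf_eq0 !negb_or => /and3P[_ c0 s0].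
rewrite /tan !mulr2n; field.
by rewrite -!mulr2n !mulrn_eq0 mulf_eq0 !negb_or x0 c0 s0.
Qed.

Theorem mainTheorem3 (R : realType) (n : nat) (a : R)
    (ha : forall k : int, a <> k%:~R * pi) :
  infinite_prod_eq n.+1
    (fun j : nat =>
      (2 ^ (j%:Z - n%:Z) / a * tan (2 ^ (n%:Z - j%:Z) * a)) ^+ (2 ^ (j - 1))%N)
    (a ^+ (2 ^ n)%N / sin a ^+ (2 ^ n)%N).
Proof.
have two0 : 2 != 0 :> R by rewrite pnatr_eq0.
have a0 : a != 0 by apply/eqP => aE; apply: (ha 0); rewrite mul0r.
pose b (j : nat) : R := 2 ^ (n%:Z - j%:Z) * a.
have bE j : b j = a * 2 ^+ n / 2 ^+ j.
  by rewrite /b expfzDr// -exprnN -exprnP mulrC mulrA.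
have b0 j : b j != 0 by rewrite /b mulf_neq0// expfz_neq0.
have bS j : b j = b j.+1 *+ 2.
  by rewrite !bE exprS -mulr_natr; field; rewrite expf_neq0.
have bn : b n = a by rewrite /b subrr expr0z mul1r.
have sb0 j : (n <= j)%N -> sin (b j) != 0.
  move=> nj; apply/eqP => /sin_eq0_intmul_pi[k kE].
  (* If [b j = k * pi], then [a = 2 ^ (j - n) * b j] is an integer multiple of [pi], because
     [n <= j]. *)
  apply: (ha (2 ^+ (j - n) * k)).
  rewrite intrM mulrAC -mulrA (mulrC pi) -kE bE rmorphXn /=.
  by rewrite -{2}(subnK nj) exprD; field; rewrite !expf_neq0.
pose f j := (sin (b j) / b j) ^+ (2 ^ j)%N.
have f0 j : (n <= j)%N -> f j != 0.
  by move=> nj; rewrite expf_neq0// mulf_neq0 ?invr_eq0 ?sb0.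
have -> : a ^+ (2 ^ n)%N / sin a ^+ (2 ^ n)%N = 1 / f n.
  by rewrite /f bn expr_div_n div1r invf_div.
have f_cvg : f @ \oo --> (1 : R).
  apply/subr_cvg0/norm_cvg0P.
  (* The bound [2 ^ j * b j ^+ 2] equals [(a * 2 ^ n) ^+ 2 / 2 ^ j], a geometric sequence of ratio
     [1 / 2]. *)
  apply: (@squeeze_cvgr _ _ _ _ (fun=> 0)
    (geometric ((a * 2 ^+ n) ^+ 2) 2^-1)); last 2 first.
  - exact: cvg_cst.
  - by apply: cvg_geometric; rewrite ger0_norm ?invr_ge0//; lra.
  apply: nearW => j; rewrite normr_ge0 distrC (le_trans (sincX_bound _ (b0 j)))//.
  rewrite bE natrX /= le_eqVlt; apply/orP; left; apply/eqP.
  by rewrite exprVn; field; rewrite expf_neq0.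
rewrite /infinite_prod_eq.
apply: (@cvg_trans _ ((fun M => f M / f n) @ \oo)); last first.
  by apply: cvgM => //; exact: cvg_cst.
(* For [M < n] the product is empty, so it is identified with [f M / f n] only eventually.
   Reindexing by [j = k + 1] makes the factor [f k.+1 / f k]. *)
apply: near_eq_cvg; exists n.+1 => // M /= nM; rewrite big_add1 /=.
rewrite (@telescope_prodf_eq _ _ _ f)//.
  by move=> k /andP[/ltnW/f0].
move=> k /andP[nk _]; rewrite subn1 /= -/(b k.+1).
have -> : 2 ^ (k.+1%:Z - n%:Z) / a = (b k.+1)^-1.
  by rewrite /b invfM invr_expz opprB.
(* The square in [tan_div_sinc] turns the exponent [2 ^ k] into the [2 ^ k.+1] of [f k.+1]; doubling
   [b k.+1] gives [b k], where [sin] is nonzero. *)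
by rewrite tan_div_sinc -?bS ?sb0// expr_div_n /f -exprM -expnS.
Qed.
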